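(* Let $P$ be a Poisson bracket on $\mathbb{R}^n$, let $\ast_\nu$ be a star-product on $(\mathbb{R}^n,P)$, and let $\rho=\sum_{r\ge0}\nu^r\rho_r$, $\rho_r:\mathsf{Pol}\to\mathsf{N}$, be the cochains of the associated sun-product. Then for every $r\ge1$, $\rho_r$ is the restriction to $\mathsf{Pol}$ of a differential operator on $\mathsf{N}$ (vanishing on constants).
   Context: $\mathsf{N}=C^\infty(\mathbb{R}^n)$, coordinates $x_1,\dots,x_n$, $\mathsf{Pol}=\mathbb{R}[x_1,\dots,x_n]$. A (differential) star-product on $(\mathbb{R}^n,P)$ is a bilinear map $f\ast_\nu g=\sum_{r\ge0}\nu^rC_r(f,g)$ from $\mathsf{N}\times\mathsf{N}$ to $\mathsf{N}[[\nu]]$, extended $\mathbb{R}[[\nu]]$-bilinearly to $\mathsf{N}[[\nu]]$, where the $C_r$ are bidifferential operators with: $C_0(f,g)=fg$; $C_r(c,f)=C_r(f,c)=0$ for $r\ge1$ and constants $c$; associativity $\sum_{s+t=r}C_s(C_t(f,g),h)=\sum_{s+t=r}C_s(f,C_t(g,h))$ for all $r\ge0$; and $C_1(f,g)-C_1(g,f)=2P(f,g)$. The cochains of the associated sun-product are the $\mathbb{R}$-linear maps $\rho_r:\mathsf{Pol}\to\mathsf{N}$ determined by $\rho(1)=1$ and, for every monomial, $\rho(x_{i_1}\cdots x_{i_k})=\frac1{k!}\sum_{\sigma\in S_k}x_{i_{\sigma(1)}}\ast_\nu\cdots\ast_\nu x_{i_{\sigma(k)}}=\sum_{r\ge0}\nu^r\rho_r(x_{i_1}\cdots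 x_{i_k})$ ($k\ge1$); then $\rho_0$ is the identity and the sun-product is $f\odot_\nu g=\rho(\pi(fg))$ where $\pi$ takes the $\nu^0$-coefficient. *)

(* Defs.v *)
From HB Require Import structures.
From mathcomp Require Import all_boot all_order all_algebra all_fingroup.
From mathcomp Require Import all_classical all_reals all_analysis.
From mathcomp Require mpoly.

Set Implicit Arguments.
Unset Strict Implicit.
Unset Printing Implicit Defensive.
Import Order.TTheory GRing.Theory Num.Theory.
Import numFieldNormedType.Exports.
Local Open Scope ring_scope.

Section Defs.
Variables (R : realType) (n : nat).

Notation V := 'rV[R]_n.

Definition partial (i : 'I_n) (f : V -> R) : V -> R :=
  fun x => 'D_(delta_mx 0 i) f x.

Definition pder (s : seq 'I_n) (f : V -> R) : V -> R :=
  foldr partial f s.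

Definition smooth (f : V -> R) : Prop :=
  forall (s : seq 'I_n) (x : V), differentiable (pder s f) x.

Definition is_diffop (D : (V -> R) -> (V -> R)) : Prop :=
  exists S : seq (seq 'I_n * (V -> R)),
    (forall p, p \in S -> smooth p.2) /\
    forall f, smooth f ->
      D f = fun x => \sum_(p <- S) p.2 x * pder p.1 f x.

Definition is_bidiffop (B : (V -> R) -> (V -> R) -> (V -> R)) : Prop :=
  exists S : seq (seq 'I_n * seq 'I_n * (V -> R)),
    (forall p, p \in S -> smooth p.2) /\
    forall f g, smooth f -> smooth g ->
      B f g = fun x => \sum_(p <- S) p.2 x * pder p.1.1 f x * pder p.1.2 g x.

Definition cst_fun (c : R) : V -> R := fun _ => c.

Definition is_poisson (P : (V -> R) -> (V -> R) -> (V -> R)) : Prop :=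
  exists pi : 'I_n -> 'I_n -> V -> R,
    (forall i j, smooth (pi i j)) /\
    (forall f g, smooth f -> smooth g ->
       P f g = fun x => \sum_(i < n) \sum_(j < n)
                          pi i j x * partial i f x * partial j g x) /\
    (forall f g, smooth f -> smooth g -> forall x, P f g x = - P g f x) /\
    (forall f g h, smooth f -> smooth g -> smooth h -> forall x,
        P f (P g h) x + P g (P h f) x + P h (P f g) x = 0).

(* star-product f *_nu g = sum_r nu^r C r f g on (R^n, P) *)
Definition is_star_product (P : (V -> R) -> (V -> R) -> (V -> R))
    (C : nat -> (V -> R) -> (V -> R) -> (V -> R)) : Prop :=
  [/\ forall r, is_bidiffop (C r),
      forall f g, smooth f -> smooth g -> C 0%N f g = fun x => f x * g x,
      forall r c f, (1 <= r)%N -> smooth f ->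
        C r (cst_fun c) f = cst_fun 0 /\ C r f (cst_fun c) = cst_fun 0,
      forall r f g h, smooth f -> smooth g -> smooth h -> forall x,
        \sum_(s < r.+1) C s (C (r - s)%N f g) h x =
        \sum_(s < r.+1) C s f (C (r - s)%N g h) x
    & forall f g, smooth f -> smooth g -> forall x,
        C 1%N f g x - C 1%N g f x = 2 * P f g x].

(* formal power series in nu with coefficients in functions R^n -> R *)
Definition series := nat -> V -> R.

(* R[[nu]]-bilinear extension of the star-product to N[[nu]] *)
Definition sstar (C : nat -> (V -> R) -> (V -> R) -> (V -> R))
    (F G : series) : series :=
  fun r x => \sum_(a < r.+1) \sum_(b < (r - a).+1)
               C a (F b) (G (r - a - b)%N) x.

Definition one_series : series := fun r _ => if r == 0%N then 1 else 0.
Definition zero_series : series := fun _ _ => 0.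

Definition coord_series (i : 'I_n) : series :=
  fun r x => if r == 0%N then x 0 i else 0.

Definition sprod C (l : seq series) : series :=
  match l with
  | [::] => one_series
  | F :: l' => foldl (sstar C) F l'
  end.

Definition rho_mono C (l : seq 'I_n) : series :=
  let L := map coord_series l in
  fun r x => (((size l)`!)%:R)^-1 *
    \sum_(sigma : 'S_(size l))
       sprod C [seq nth zero_series L (sigma j) | j <- enum 'I_(size l)] r x.

Definition mono_seq (m : mpoly.multinom n) : seq 'I_n :=
  flatten [seq nseq (mpoly.fun_of_multinom m i) i | i <- enum 'I_n].

Definition rho C (r : nat) (p : mpoly.mpoly n R) : V -> R :=
  fun x => \sum_(m <- mpoly.msupp p) mpoly.mcoeff m p * rho_mono C (mono_seq m) r x.

Definition pol_fun (p : mpoly.mpoly n R) : V -> R :=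
  fun x => mpoly.meval (fun i => x 0 i) p.

End Defs.

(* Main.v *)
(* Let [x_w] be the product of the letters of a word [w] in the coordinates, and
   let [S_r w] be the [nu^r]-coefficient of the sum over all permutations of the
   corresponding star-products. Sorting the permutations by their last letter gives
     [S_r w = sum_j sum_(a <= r) C_a (S_(r-a) (w minus w_j), x_(w_j))],
   so if [S_s w = |w|! D_s x_w] with [D_s] a differential operator for [s < r], then
   [D_r] must satisfy [|w| D_r x_w = sum_i (x_i D_r + E_i) (d_i x_w)], where
   [E_i f = sum_(0 < a <= r) C_a (D_(r-a) f, x_i)] is a differential operator. If
   [E_i = sum_al e_(i,al) d^al], Euler's identity for homogeneous polynomials shows
   that [D_r = sum_(i,al) e_(i,al) / (|al| + 1) d^al d_i] is a solution. *)
Require Import Defs.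
From HB Require Import structures.
From mathcomp Require Import all_boot all_order all_algebra all_fingroup.
From mathcomp Require Import all_classical all_reals all_analysis.
From mathcomp Require Import ring.
From mathcomp Require mpoly.
Import GRing.Theory Num.Theory.
Local Open Scope ring_scope.

(** * Calculus of smooth functions and differential operators *)

Section Smooth.
Context {R : realType} {n : nat}.
Notation V := 'rV[R]_n.
Implicit Types (f g : V -> R) (i j : 'I_n) (s : seq 'I_n).

Definition coord i : V -> R := fun x => x 0 i.

Lemma partialD i f g : (forall x, differentiable f x) ->
  (forall x, differentiable g x) ->
  partial i (f + g) = partial i f + partial i g.
Proof.
by move=> df dg; apply/funext => x; rewrite /partial deriveD//; exact: diff_derivable.
Qed.

Lemma partialM i f g : (forall x, differentiable f x) ->
  (forall x, differentiable g x) ->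
  partial i (f * g) = f * partial i g + partial i f * g.
Proof.
move=> df dg; apply/funext => x; rewrite /partial deriveM//; last 2 first.
- exact: diff_derivable.
- exact: diff_derivable.
by congr (_ + _); rewrite /GRing.scale/= mulrC.
Qed.

Lemma partial_cst i (c : R) : partial i (@cst_fun R n c) = 0.
Proof. by apply/funext => x; rewrite /partial derive_cst. Qed.

Lemma differentiable_cst_fun (c : R) x : differentiable (@cst_fun R n c) x.
Proof. exact: differentiable_cst. Qed.

Lemma differentiable_coord_fun i x : differentiable (coord i) x.
Proof. exact: differentiable_coord. Qed.

Lemma partial_coord i j : partial i (coord j) = @cst_fun R n (i == j)%:R.
Proof.
apply/funext => x; rewrite /partial /cst_fun.
have hl : linear (coord j) by move=> a u v; rewrite /coord !mxE.
(* A linear map is its own differential, so [coord j] is packed as a linear map. *)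
pose L := GRing.isLinear.Build R V R^o *:%R (coord j) hl.
pose F : {linear V -> R^o} := HB.pack (coord j) L.
have -> : coord j = F by [].
rewrite deriveE; last exact: differentiable_coord_fun.
rewrite diff_lin; first by rewrite /= /coord mxE eqxx eq_sym.
by move=> y; apply: differentiable_continuous; exact: differentiable_coord_fun.
Qed.

Lemma smooth_diff f x : smooth f -> differentiable f x.
Proof. by move=> /(_ [::] x). Qed.
Hint Resolve smooth_diff : core.

Lemma smooth_partial i f : smooth f -> smooth (partial i f).
Proof. by move=> sf s x; have := sf (rcons s i) x; rewrite /pder foldr_rcons. Qed.

Lemma smooth_pder s f : smooth f -> smooth (pder s f).
Proof. by move=> sf; elim: s => //= i s; exact: smooth_partial. Qed.

(** Smooth functions form the largest class of differentiable functions stable under [partial], so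
    smoothness can be proved by exhibiting any such class. *)
Lemma smooth_coind (A : (V -> R) -> Prop) :
  (forall f, A f -> forall x, differentiable f x) ->
  (forall i f, A f -> A (partial i f)) -> forall f, A f -> smooth f.
Proof.
move=> dA pA f Af s x; apply: dA; elim: s => //= i s; exact: pA.
Qed.

Lemma smooth_cst (c : R) : smooth (@cst_fun R n c).
Proof.
apply: (@smooth_coind (fun f => exists c, f = cst_fun c)); last by exists c.
  by move=> _ [d ->] x; exact: differentiable_cst_fun.
by move=> i _ [d ->]; exists 0; rewrite partial_cst.
Qed.

Lemma smooth0 : smooth (0 : V -> R). Proof. exact: smooth_cst. Qed.

(** By the Leibniz rule a derivative of a product is a sum of products, so a class suited to
    [smooth_coind] has to be closed under both operations. *)
Inductive smooth_alg : (V -> R) -> Prop :=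
| smooth_alg_gen f : smooth f -> smooth_alg f
| smooth_algD f g : smooth_alg f -> smooth_alg g -> smooth_alg (f + g)
| smooth_algM f g : smooth_alg f -> smooth_alg g -> smooth_alg (f * g).

Lemma smooth_alg_smooth f : smooth_alg f -> smooth f.
Proof.
have dA g : smooth_alg g -> forall x, differentiable g x.
  elim=> [{}g sg x|g1 g2 _ d1 _ d2 x|g1 g2 _ d1 _ d2 x]; first exact: smooth_diff.
  - exact: differentiableD.
  - exact: differentiableM.
apply: smooth_coind => // i g; elim=> [{}g sg|g1 g2 A1 p1 A2 p2|g1 g2 A1 p1 A2 p2].
- by apply: smooth_alg_gen; exact: smooth_partial.
- by rewrite partialD; [exact: smooth_algD|exact: dA..].
- by rewrite partialM; [apply: smooth_algD; exact: smooth_algM|exact: dA..].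
Qed.

Lemma smoothD f g : smooth f -> smooth g -> smooth (f + g).
Proof.
by move=> sf sg; apply: smooth_alg_smooth; apply: smooth_algD; exact: smooth_alg_gen.
Qed.

Lemma smoothM f g : smooth f -> smooth g -> smooth (f * g).
Proof.
by move=> sf sg; apply: smooth_alg_smooth; apply: smooth_algM; exact: smooth_alg_gen.
Qed.

Lemma smooth_sum (I : eqType) (r : seq I) (F : I -> V -> R) :
  (forall k, k \in r -> smooth (F k)) -> smooth (\sum_(k <- r) F k).
Proof.
move=> sF; rewrite big_seq; apply: (big_ind (@smooth R n)) => //.
- exact: smooth0.
- exact: smoothD.
Qed.

Lemma smooth_coord i : smooth (coord i).
Proof.
move=> s x; case: (lastP s) => [|{}s j]; first exact: differentiable_coord_fun.
by rewrite /pder foldr_rcons partial_coord; exact: smooth_cst.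
Qed.

Lemma pderD s f g : smooth f -> smooth g -> pder s (f + g) = pder s f + pder s g.
Proof.
by move=> sf sg; elim: s => //= i s ->; rewrite partialD// => x;
  apply: smooth_diff; exact: smooth_pder.
Qed.

Lemma pder_cst s (c : R) : pder s (cst_fun c) = @cst_fun R n (if s is [::] then c else 0).
Proof.
by elim: s => //= i s ->; rewrite partial_cst.
Qed.

Lemma pder_sum s (I : eqType) (r : seq I) (F : I -> V -> R) :
  (forall k, k \in r -> smooth (F k)) ->
  pder s (\sum_(k <- r) F k) = \sum_(k <- r) pder s (F k).
Proof.
elim: r => [_|k r ih sF].
  by rewrite !big_nil (_ : 0 = cst_fun 0)// pder_cst; case: s.
rewrite !big_cons pderD ?ih//.
- by move=> l lr; apply: sF; rewrite inE lr orbT.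
- by apply: sF; rewrite inE eqxx.
- by apply: smooth_sum => l lr; apply: sF; rewrite inE lr orbT.
Qed.

Lemma pderZ s (c : R) f : smooth f -> pder s (cst_fun c * f) = cst_fun c * pder s f.
Proof.
by move=> sf; elim: s => //= i s ->; rewrite partialM ?partial_cst ?mul0r ?addr0.
Qed.

Lemma diffop_ext (D D' : (V -> R) -> (V -> R)) :
  (forall f, smooth f -> D f = D' f) -> is_diffop D -> is_diffop D'.
Proof. by move=> DD' [S [sS SE]]; exists S; split=> // f sf; rewrite -DD'// SE. Qed.

Lemma diffopE (S : seq (seq 'I_n * (V -> R))) f :
  (fun x => \sum_(p <- S) p.2 x * pder p.1 f x) = \sum_(p <- S) p.2 * pder p.1 f.
Proof. by apply/funext => x; rewrite fct_sumE. Qed.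

Lemma diffop_term s c : smooth c -> is_diffop (fun f => c * pder s f).
Proof.
move=> sc; exists [:: (s, c)]; split; first by move=> p; rewrite inE => /eqP ->.
by move=> f sf; rewrite diffopE big_seq1.
Qed.

Lemma diffopD (D D' : (V -> R) -> (V -> R)) :
  is_diffop D -> is_diffop D' -> is_diffop (fun f => D f + D' f).
Proof.
move=> [S [sS SE]] [S' [sS' SE']]; exists (S ++ S'); split.
  by move=> p; rewrite mem_cat => /orP[/sS|/sS'].
by move=> f sf; rewrite diffopE big_cat/= SE// SE'// !diffopE.
Qed.

Lemma diffop_sum (I : eqType) (r : seq I) (D : I -> (V -> R) -> (V -> R)) :
  (forall k, k \in r -> is_diffop (D k)) ->
  is_diffop (fun f => \sum_(k <- r) D k f).
Proof.
elim: r => [_|k r ih dD].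
  by exists [::]; split=> // f _; rewrite big_nil diffopE big_nil.
apply: (@diffop_ext (fun f => D k f + \sum_(k <- r) D k f)).
  by move=> f _; rewrite big_cons.
apply: diffopD; first by apply: dD; rewrite inE eqxx.
by apply: ih => l lr; apply: dD; rewrite inE lr orbT.
Qed.

Lemma diffop_id : is_diffop (id : (V -> R) -> (V -> R)).
Proof.
apply: (@diffop_ext (fun f => cst_fun 1 * pder [::] f)).
  by move=> f _; exact: mul1r.
by apply: diffop_term; exact: smooth_cst.
Qed.

Lemma diffopM c (D : (V -> R) -> (V -> R)) :
  smooth c -> is_diffop D -> is_diffop (fun f => c * D f).
Proof.
move=> sc [S [sS SE]].
apply: (@diffop_ext (fun f => \sum_(p <- S) c * p.2 * pder p.1 f)).
  move=> f sf; rewrite SE// diffopE big_distrr/=.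
  by apply: eq_bigr => p _; rewrite mulrA.
by apply: diffop_sum => p pS; apply: diffop_term; apply: smoothM => //; exact: sS.
Qed.

Lemma diffop_smooth (D : (V -> R) -> (V -> R)) f :
  is_diffop D -> smooth f -> smooth (D f).
Proof.
move=> [S [sS SE]] sf; rewrite SE// diffopE; apply: smooth_sum => p pS.
by apply: smoothM; [exact: sS|exact: smooth_pder].
Qed.

(** By the Leibniz rule a term $c\,\partial^s$ becomes $c\,\partial_i\partial^s+(\partial_i
    c)\,\partial^s$. *)
Lemma diffop_partial i (D : (V -> R) -> (V -> R)) :
  is_diffop D -> is_diffop (fun f => partial i (D f)).
Proof.
move=> [S [sS SE]].
apply: (@diffop_ext (fun f => \sum_(p <- S)
    (p.2 * pder (i :: p.1) f + partial i p.2 * pder p.1 f))).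
  move=> f sf; rewrite SE// diffopE -[RHS]/(pder [:: i] _) pder_sum/=.
    rewrite !big_seq; apply: eq_bigr => p pS.
    by rewrite partialM// => x; apply: smooth_diff; exact: sS.
  by move=> p pS; apply: smoothM; [exact: sS|exact: smooth_pder].
apply: diffop_sum => p pS; apply: diffopD; apply: diffop_term; first exact: sS.
by apply: smooth_partial; exact: sS.
Qed.

Lemma diffop_pder s (D : (V -> R) -> (V -> R)) :
  is_diffop D -> is_diffop (fun f => pder s (D f)).
Proof. by move=> dD; elim: s => //= i s; exact: diffop_partial. Qed.

Lemma diffop_lin (D : (V -> R) -> (V -> R)) (I : eqType) (r : seq I)
    (F : I -> V -> R) : is_diffop D -> (forall k, k \in r -> smooth (F k)) ->
  D (\sum_(k <- r) F k) = \sum_(k <- r) D (F k).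
Proof.
move=> [S [sS SE]] sF; rewrite SE ?diffopE; last exact: smooth_sum.
under eq_bigr do rewrite pder_sum// big_distrr/=.
rewrite exchange_big/= [RHS]big_seq [LHS]big_seq; apply: eq_bigr => k kr.
by rewrite SE ?diffopE//; exact: sF.
Qed.

Lemma diffopZ (D : (V -> R) -> (V -> R)) (c : R) f : is_diffop D -> smooth f ->
  D (cst_fun c * f) = cst_fun c * D f.
Proof.
move=> [S [sS SE]] sf.
rewrite !SE ?diffopE//; last by apply: smoothM => //; exact: smooth_cst.
by rewrite big_distrr/=; apply: eq_bigr => p _; rewrite pderZ// mulrCA.
Qed.

End Smooth.

(** * Polynomial functions, Euler's identity and monomials given by words *)

Section Words.
Context {R : realType} {n : nat}.
Notation V := 'rV[R]_n.
Implicit Types (f g : V -> R) (i j : 'I_n) (s : seq 'I_n).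

(* Otherwise failing unifications unfold derivatives and diverge. *)
#[local] Opaque partial coord.

Lemma smooth_coordM i f : smooth f -> smooth (coord i * f).
Proof. by move=> sf; apply: smoothM; [exact: smooth_coord|exact: sf]. Qed.

Lemma cst_fun_nat k : cst_fun k%:R = k%:R :> (V -> R).
Proof.
elim: k => // k ih; rewrite -[in RHS]natr1 -ih.
by apply/funext => x; rewrite /cst_fun -natr1.
Qed.

(** Commutation of partial derivatives is needed on polynomials only; this generation, one
    coordinate factor at a time, allows an elementary induction. *)
Inductive poly_fun : (V -> R) -> Prop :=
| poly_cst (c : R) : poly_fun (cst_fun c)
| poly_coordM i f : poly_fun f -> poly_fun (coord i * f)
| poly_add f g : poly_fun f -> poly_fun g -> poly_fun (f + g).

Lemma poly_smooth f : poly_fun f -> smooth f.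
Proof.
elim=> [c|i g _ sg|g h _ sg _ sh]; first exact: smooth_cst.
- exact: smooth_coordM.
- exact: smoothD.
Qed.

Lemma partial_coordM i j f : smooth f ->
  partial i (coord j * f) = coord j * partial i f + (if i == j then f else 0).
Proof.
move=> sf; rewrite partialM; last 2 first.
- by move=> x; exact: differentiable_coord_fun.
- by move=> x; exact: smooth_diff.
by rewrite partial_coord; case: eqP => _; congr (_ + _); [exact: mul1r|exact: mul0r].
Qed.

Lemma partialD_smooth i f g : smooth f -> smooth g ->
  partial i (f + g) = partial i f + partial i g.
Proof. by move=> sf sg; rewrite partialD// => x; exact: smooth_diff. Qed.

Lemma poly_partial i f : poly_fun f -> poly_fun (partial i f).
Proof.
elim=> [c|j g pg ig|g h pg ig ph ih].
- by rewrite partial_cst; exact: (poly_cst 0).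
- rewrite partial_coordM; last exact: poly_smooth.
  apply: poly_add; first exact: poly_coordM.
  by case: ifP => // _; exact: (poly_cst 0).
- by rewrite partialD_smooth; [exact: poly_add|exact: poly_smooth..].
Qed.

Lemma poly_pder s f : poly_fun f -> poly_fun (pder s f).
Proof. by move=> pf; elim: s => //= i s; exact: poly_partial. Qed.

Lemma partialC i j f : poly_fun f ->
  partial i (partial j f) = partial j (partial i f).
Proof.
elim=> [c|l g pg ig|g h pg ig ph ih].
- by rewrite !partial_cst (_ : 0 = cst_fun 0)// !partial_cst.
- have sg := poly_smooth _ pg.
  have sp m : smooth (partial m g) by exact: smooth_partial.
  have pif (b : bool) m : partial m (if b then g else 0) = if b then partial m g else 0.
    by case: b; [|exact: partial_cst].
  have sif (b : bool) : smooth (if b then g else 0).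
    by case: b; [exact: sg|exact: smooth0].
  (* Apart from the second derivative of [g], handled by induction, the right-hand side is symmetric
     in [a] and [b]. *)
  have E a b : partial a (partial b (coord l * g)) = coord l * partial a (partial b g) +
      ((if a == l then partial b g else 0) + (if b == l then partial a g else 0)).
    rewrite (partial_coordM _ _ _ sg) (partialD_smooth _ _ _ (smooth_coordM _ _ (sp b)) (sif _)).
    by rewrite (partial_coordM _ _ _ (sp b)) pif addrA.
  by rewrite (E i j) (E j i) ig [X in _ = _ + X]addrC.
- have [sg sh] := (poly_smooth _ pg, poly_smooth _ ph).
  have sp m (e : V -> R) : smooth e -> smooth (partial m e) by exact: smooth_partial.
  rewrite (partialD_smooth j g h sg sh) (partialD_smooth i _ _ (sp _ _ sg) (sp _ _ sh)).
  by rewrite (partialD_smooth i g h sg sh) (partialD_smooth j _ _ (sp _ _ sg) (sp _ _ sh)) ig ih.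
Qed.

Lemma pder_partialC s i f : poly_fun f -> pder s (partial i f) = partial i (pder s f).
Proof.
move=> pf; elim: s => //= j s ->; rewrite partialC//; exact: poly_pder.
Qed.

(* Differentiating Euler's identity for a homogeneous [f] lowers the degree by one each time. *)
Lemma euler_pder (k : nat) s f : poly_fun f ->
  \sum_i coord i * partial i f = cst_fun k%:R * f ->
  \sum_i coord i * pder s (partial i f) =
  cst_fun (k%:R - (size s)%:R) * pder s f.
Proof.
move=> pf Ef; elim: s => [|j s ih]; first by rewrite subr0.
have sP t : smooth (pder t f) by apply: smooth_pder; exact: poly_smooth.
have sp i : smooth (pder s (partial i f)).
  by apply: smooth_pder; apply: smooth_partial; exact: poly_smooth.
have sc i : smooth (coord i * pder s (partial i f)).
  exact: smooth_coordM.
have := congr1 (pder [:: j]) ih.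
rewrite pder_sum// pderZ//=.
under eq_bigr do rewrite partial_coordM//.
(* Differentiating the factor [coord i] leaves an extra term only for [i = j]. By commutation it
   equals [pder (j :: s) f]; moved to the other side, it lowers the scalar by one. *)
rewrite big_split/= -big_mkcond [X in _ + X](big_pred1 j)/=; last first.
  by move=> i; rewrite /= eq_sym.
rewrite [X in _ + X](pder_partialC _ _ _ pf) -/(pder (j :: s) f) => E.
have -> : cst_fun (k%:R - (size (j :: s))%:R) = cst_fun (k%:R - (size s)%:R) - 1 :> (V -> R).
  by apply/funext => x; rewrite /cst_fun/= -natr1 opprD addrA.
by rewrite mulrBl mul1r; exact: canRL (addrK _) E.
Qed.

(** Words are functions on ordinals, so that deleting the letter at [j] is composition with [lift j]
    and permuting letters is composition with a permutation. *)
Definition word_fun k (w : 'I_k -> 'I_n) : V -> R := \prod_(j < k) coord (w j).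

Lemma word_funD1 k (w : 'I_k.+1 -> 'I_n) (j : 'I_k.+1) :
  word_fun _ w = coord (w j) * word_fun _ (w \o lift j).
Proof. by rewrite /word_fun (bigD1_ord j). Qed.

Lemma poly_word_fun k (w : 'I_k -> 'I_n) : poly_fun (word_fun k w).
Proof.
elim: k w => [|k ih] w; first by rewrite /word_fun big_ord0; exact: (poly_cst 1).
by rewrite (word_funD1 _ _ ord0); exact: poly_coordM.
Qed.

Lemma smooth_word_fun k (w : 'I_k -> 'I_n) : smooth (word_fun k w).
Proof. exact/poly_smooth/poly_word_fun. Qed.

Lemma partial_word_fun k (w : 'I_k.+1 -> 'I_n) i :
  partial i (word_fun _ w) = \sum_(j | i == w j) word_fun _ (w \o lift j).
Proof.
elim: k w => [|k ih] w; rewrite (word_funD1 _ _ ord0) partial_coordM//;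
    try exact: smooth_word_fun.
  rewrite big_mkcond big_ord1/= {1}/word_fun big_ord0 -[1]/(cst_fun 1) partial_cst.
  by rewrite mulr0 add0r.
rewrite ih [RHS]big_mkcond big_ord_recl/= addrC; congr (_ + _).
rewrite -big_mkcond/= big_distrr/=; apply: eq_bigr => j _.
(* Deleting position [j] of the tail amounts to deleting position [j + 1] of [w], with the first
   letter kept. *)
rewrite [RHS](word_funD1 _ _ ord0); congr (coord (w _) * _).
  by apply/val_inj.
rewrite /word_fun; apply: eq_bigr => m _; congr (coord (w _)).
by apply/val_inj; rewrite /= /bump !leq0n !add1n ltnS addnS.
Qed.

(** Each of the [k.+1] positions contributes its letter times the word without it, that is, the
    whole monomial. *)
Lemma euler_word_fun k (w : 'I_k.+1 -> 'I_n) :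
  \sum_i coord i * partial i (word_fun _ w) = cst_fun k.+1%:R * word_fun _ w.
Proof.
under eq_bigr do rewrite partial_word_fun big_distrr/=.
rewrite (exchange_big_dep xpredT)//=.
under eq_bigr => j _ do rewrite big_pred1_eq -word_funD1.
by rewrite sumr_const card_ord cst_fun_nat mulr_natl.
Qed.

End Words.

(** The permutations sending [i] to [j] are exactly the [lift_perm i j s]. With [i] the last index,
    this sorts the orderings of a word by their last letter. *)
Lemma sum_lift_perm (A : nmodType) k (F : 'S_k.+1 -> A) (i : 'I_k.+1) :
  \sum_s F s = \sum_j \sum_s F (lift_perm i j s).
Proof.
rewrite (partition_big (fun s : 'S_k.+1 => s i) xpredT)//=.
apply: eq_bigr => j _; rewrite (reindex (lift_perm i j)); last first.
  (* The inverse of [lift_perm i j]: delete [i] and its image. The default [m] never occurs, since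
     [s (lift i m)] differs from [s i]. *)
  pose ulsf (s : 'S_k.+1) m := odflt m (unlift (s i) (s (lift i m))).
  have ulsfK (s : 'S_k.+1) m : lift (s i) (ulsf s m) = s (lift i m).
    rewrite /ulsf; have := neq_lift i m.
    by rewrite -(inj_eq (@perm_inj _ s)) => /unlift_some[] ? ? ->.
  have ulsf_inj s : injective (ulsf s).
    move=> a b /(congr1 (lift (s i))); rewrite !ulsfK => /perm_inj.
    exact: lift_inj.
  exists (fun s => perm (ulsf_inj s)) => [s _ | s].
    by apply/permP => m; rewrite permE /ulsf lift_perm_lift lift_perm_id liftK.
  move=> /(s _ =P _) si; apply/permP => m.
  case: (unliftP i m) => [m'|] ->; rewrite ?lift_perm_id//.
  by rewrite lift_perm_lift -si permE ulsfK.
by apply: eq_bigl => s; rewrite lift_perm_id eqxx.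
Qed.

(** * Star-products of words and their symmetrization *)

Section Star.
Context {R : realType} {n : nat}.
Notation V := 'rV[R]_n.
Implicit Types (f g : V -> R) (i j : 'I_n) (s : seq 'I_n).
#[local] Opaque partial coord.

(** With [g] fixed, its derivatives are absorbed into the coefficients. The case [D = id] gives
    linearity of [B] in its first argument on smooth functions. *)
Lemma bidiffop_diffop (B : (V -> R) -> (V -> R) -> (V -> R)) D g :
  is_bidiffop B -> is_diffop D -> smooth g -> is_diffop (fun f => B (D f) g).
Proof.
move=> [S [sS SE]] dD sg.
apply: (@diffop_ext _ _ (fun f => \sum_(p <- S)
    (p.2 * pder p.1.2 g) * pder p.1.1 (D f))).
  move=> f sf; rewrite SE//; last exact: diffop_smooth.
  apply/funext => x; rewrite fct_sumE; apply: eq_bigr => p _.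
  by rewrite /GRing.mul/= mulrAC.
apply: diffop_sum => p pS; apply: diffopM; last exact: diffop_pder.
by apply: smoothM; [exact: sS|exact: smooth_pder].
Qed.

Lemma bidiffop_smooth (B : (V -> R) -> (V -> R) -> (V -> R)) f g :
  is_bidiffop B -> smooth f -> smooth g -> smooth (B f g).
Proof.
move=> bB sf sg.
exact: (diffop_smooth _ f (bidiffop_diffop B id g bB diffop_id sg) sf).
Qed.

Context (C : nat -> (V -> R) -> (V -> R) -> (V -> R)).
Context (Cbi : forall r, is_bidiffop (C r)).
Context (C0 : forall f g, smooth f -> smooth g -> C 0 f g = f * g).
Context (Cunit : forall r c f, (1 <= r)%N -> smooth f ->
  C r (cst_fun c) f = cst_fun 0 /\ C r f (cst_fun c) = cst_fun 0).

Definition smooth_series (F : nat -> V -> R) := forall r, smooth (F r).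

Lemma C_0l a f : smooth f -> C a 0 f = 0.
Proof.
case: a => [|a] sf; last exact: (Cunit _ 0 f _ sf).1.
by rewrite C0 ?mul0r//; exact: smooth0.
Qed.

Lemma C_0r a f : smooth f -> C a f 0 = 0.
Proof.
case: a => [|a] sf; last exact: (Cunit _ 0 f _ sf).2.
by rewrite C0 ?mulr0//; exact: smooth0.
Qed.

Lemma sstarE F G r : sstar C F G r =
  \sum_(a < r.+1) \sum_(b < (r - a).+1) C a (F b) (G (r - a - b)%N).
Proof.
apply/funext => x; rewrite /sstar fct_sumE; apply: eq_bigr => a _.
by rewrite fct_sumE.
Qed.

Lemma smooth_sstar F G : smooth_series F -> smooth_series G ->
  smooth_series (sstar C F G).
Proof.
move=> sF sG r; rewrite sstarE; apply: smooth_sum => a _; apply: smooth_sum => b _.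
by apply: bidiffop_smooth; [exact: Cbi|exact: sF|exact: sG].
Qed.

Lemma smooth_one_series : smooth_series (@one_series R n).
Proof. by case=> [|r]; [exact: (smooth_cst 1)|exact: smooth0]. Qed.

Lemma smooth_coord_series i : smooth_series (@coord_series R n i).
Proof. by case=> [|r]; [exact: smooth_coord|exact: smooth0]. Qed.

Lemma sstar_one F : smooth_series F -> sstar C (@one_series R n) F = F.
Proof.
move=> sF; apply/funext => r; rewrite sstarE big_ord_recl big_ord_recl/= subn0.
rewrite big1 ?addr0 => [|b _]; last by apply: C_0l; exact: sF.
rewrite big1 ?addr0 => [|a _].
  rewrite C0; [|exact: (smooth_cst 1)|exact: sF].
  by rewrite subn0; exact: mul1r.
rewrite big1// => -[[|b] ltb] _ /=; last by apply: C_0l; exact: sF.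
exact: (Cunit _ 1 _ _ (sF _)).1.
Qed.

(** The product associates to the left, so the last factor splits off; the unit law is needed only
    for empty [l], as [sprod] starts from its first factor. *)
Lemma sprod_rcons l F : smooth_series F ->
  sprod C (rcons l F) = sstar C (sprod C l) F.
Proof.
by case: l => [sF|G l _] /=; [rewrite sstar_one|rewrite foldl_rcons].
Qed.

(** A coordinate series lives in degree 0, so for each [a] only the term [b = r - a] survives. *)
Lemma sstar_coord F i r : smooth_series F ->
  sstar C F (@coord_series R n i) r = \sum_(a < r.+1) C a (F (r - a)%N) (coord i).
Proof.
move=> sF; rewrite sstarE; apply: eq_bigr => a _.
rewrite big_ord_recr/= subnn big1 ?add0r// => b _.
have : (0 < r - a - b)%N by rewrite subn_gt0.
by case: (r - a - b)%N => // m _; apply: C_0r; exact: sF.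
Qed.

Definition word_sprod k (w : 'I_k -> 'I_n) :=
  sprod C [seq @coord_series R n (w m) | m <- enum 'I_k].

Lemma word_sprod_recr k (w : 'I_k.+1 -> 'I_n) :
  word_sprod _ w = sstar C (word_sprod _ (w \o lift ord_max)) (coord_series (w ord_max)).
Proof.
rewrite /word_sprod enum_ordSr map_rcons sprod_rcons; last exact: smooth_coord_series.
congr (sstar C (sprod C _) _); rewrite -map_comp; apply: eq_map => m /=.
by congr (coord_series (w _)); apply/val_inj; rewrite /= /bump leqNgt ltn_ord.
Qed.

Lemma smooth_word_sprod k (w : 'I_k -> 'I_n) : smooth_series (word_sprod k w).
Proof.
elim: k w => [|k ih] w.
  by rewrite /word_sprod (size0nil (size_enum_ord 0)); exact: smooth_one_series.
by rewrite word_sprod_recr; apply: smooth_sstar; [exact: ih|exact: smooth_coord_series].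
Qed.

(** Leaving out the factor $1/k!$ makes the recursion on the length free of coefficients. *)
Definition sym_sprod k (w : 'I_k -> 'I_n) r : V -> R :=
  \sum_(s : 'S_k) word_sprod k (w \o s) r.

Lemma sym_sprod_recr k (w : 'I_k.+1 -> 'I_n) r :
  sym_sprod _ w r = \sum_j \sum_(a < r.+1)
    C a (sym_sprod _ (w \o lift j) (r - a)%N) (coord (w j)).
Proof.
rewrite /sym_sprod (sum_lift_perm _ _ _ ord_max); apply: eq_bigr => j _.
transitivity (\sum_(s : 'S_k) \sum_(a < r.+1)
    C a (word_sprod _ ((w \o lift j) \o s) (r - a)%N) (coord (w j))).
  apply: eq_bigr => s _; rewrite word_sprod_recr -sstar_coord.
    rewrite /= lift_perm_id; congr (sstar C (word_sprod _ _) _ _).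
    by apply/funext => m; rewrite /= lift_perm_lift.
  exact: smooth_word_sprod.
rewrite exchange_big; apply: eq_bigr => a _ /=.
(* Linearity of [C a] in its first argument moves the sum over [s] inside. *)
have dC := bidiffop_diffop (C a) id (coord (w j)) (Cbi a) diffop_id (smooth_coord _).
by rewrite (diffop_lin _ _ _ _ dC) => // s _; exact: smooth_word_sprod.
Qed.

End Star.

(** * Differential operators for the cochains *)

Section SunProduct.
Context {R : realType} {n : nat}.
Notation V := 'rV[R]_n.
Implicit Types (f g : V -> R) (i : 'I_n) (s : seq 'I_n).
#[local] Opaque partial coord.

(** Positions are grouped by their letter: by linearity, the shortened words with deleted letter [i]
    add up to the partial derivative in direction [i]. *)
Lemma sum_word_fun (F : 'I_n -> (V -> R) -> (V -> R)) k (w : 'I_k.+1 -> 'I_n) :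
  (forall i, is_diffop (F i)) ->
  \sum_j F (w j) (word_fun _ (w \o lift j)) = \sum_i F i (partial i (word_fun _ w)).
Proof.
move=> dF.
transitivity (\sum_i \sum_(j | i == w j) F i (word_fun _ (w \o lift j))).
  rewrite (exchange_big_dep xpredT)//=; apply: eq_bigr => j _.
  by rewrite big_pred1_eq.
apply: eq_bigr => i _; rewrite partial_word_fun -big_filter -[in RHS]big_filter.
by rewrite (diffop_lin _ _ _ _ (dF i)) => // j _; exact: smooth_word_fun.
Qed.

Lemma recurrence_diffop (E : 'I_n -> (V -> R) -> (V -> R)) :
  (forall i, is_diffop (E i)) ->
  exists D, [/\ is_diffop D, forall c, D (cst_fun c) = 0 &
    forall k (w : 'I_k.+1 -> 'I_n), cst_fun k.+1%:R * D (word_fun _ w) =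
      \sum_j (coord (w j) * D (word_fun _ (w \o lift j)) +
              E (w j) (word_fun _ (w \o lift j)))].
Proof.
move=> dE.
have /choice[S SE] := dE.
pose b (p : seq 'I_n * (V -> R)) : V -> R := cst_fun (size p.1).+1%:R^-1 * p.2.
(* [rcons] makes $\partial_i$ the innermost derivative, matching [E i] applied to [partial i f].
   Every term thus has positive order and kills constants. *)
pose D f : V -> R := \sum_i \sum_(p <- S i) b p * pder (rcons p.1 i) f.
have dD : is_diffop D.
  apply: diffop_sum => i _; apply: diffop_sum => p pS; apply: diffop_term.
  by apply: smoothM; [exact: smooth_cst|exact: (SE i).1].
exists D; split=> // [c|k w].
  rewrite /D big1// => i _; rewrite big1// => p _.
  by rewrite pder_cst; case: (p.1) => [|? ?]; exact: mulr0.
have sw : smooth (word_fun _ w : V -> R) by exact: smooth_word_fun.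
rewrite (sum_word_fun (fun i f => coord i * D f + E i f)) => [|i]; last first.
  by apply: diffopD; [apply: diffopM; [exact: smooth_coord|exact: dD]|exact: dE].
rewrite big_split/= /D.
under eq_bigr do rewrite big_distrr/=.
rewrite exchange_big/= -big_split/= big_distrr/=; apply: eq_bigr => i _.
under [X in _ = X + _]eq_bigr do rewrite big_distrr/=.
rewrite exchange_big/= (SE i).2; last exact: smooth_partial.
rewrite diffopE -big_split/= big_distrr/=; apply: eq_bigr => p _.
under [X in _ = X + _]eq_bigr do rewrite mulrCA.
rewrite -big_distrr/= (euler_pder k.+1) ?size_rcons; last 2 first.
- exact: poly_word_fun.
- exact: euler_word_fun.
rewrite -[pder p.1 (partial i _)](foldr_rcons _ _ p.1 i) -/(pder (rcons p.1 i) _).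
rewrite !mulrA -mulrDl; congr (_ * _).
(* Euler's identity in degree [a] and order [q] has left the scalar identity $a/q=(a-q)/q+1$, which
   explains the factor $1/q$ in [b]. *)
apply/funext => x; set a : R := k.+1%:R; set q : R := (size p.1).+1%:R.
rewrite -[LHS]/(a / q * p.2 x) -[RHS]/(q^-1 * p.2 x * (a - q) + p.2 x).
have q0 : q != 0 by rewrite pnatr_eq0.
by field.
Qed.

Context (C : nat -> (V -> R) -> (V -> R) -> (V -> R)).
Context (Cbi : forall r, is_bidiffop (C r)).
Context (C0 : forall f g, smooth f -> smooth g -> C 0 f g = f * g).
Context (Cunit : forall r c f, (1 <= r)%N -> smooth f ->
  C r (cst_fun c) f = cst_fun 0 /\ C r f (cst_fun c) = cst_fun 0).

Lemma smooth_sym_sprod k (w : 'I_k -> 'I_n) r : smooth (sym_sprod C k w r).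
Proof. by apply: smooth_sum => s _; exact: smooth_word_sprod. Qed.

Lemma sym_sprod0 (w : 'I_0 -> 'I_n) r : sym_sprod C _ w r = one_series r.
Proof.
rewrite /sym_sprod (big_pred1 1%g); last by move=> s; apply/esym/eqP/permP => -[].
by rewrite /word_sprod (size0nil (size_enum_ord 0)).
Qed.

(** Strong induction on the order [r], with an inner induction on word length; a single [D] serves
    all lengths. *)
Lemma sym_sprod_diffop r : exists D, [/\ is_diffop D,
  (0 < r)%N -> forall c, D (cst_fun c) = 0 &
  forall k (w : 'I_k -> 'I_n), sym_sprod C _ w r = cst_fun k`!%:R * D (word_fun _ w)].
Proof.
elim/ltn_ind: r => -[_|r ih].
  exists id; split=> //; first exact: diffop_id.
  elim=> [|k ih] w.
    by rewrite sym_sprod0 /word_fun big_ord0 mulr1; apply/funext.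
  rewrite sym_sprod_recr//.
  transitivity (\sum_(j < k.+1) cst_fun k`!%:R * (word_fun _ w : V -> R)).
    apply: eq_bigr => j _; rewrite big_ord1 C0 ?ih.
    - by rewrite (word_funD1 _ _ j) [in RHS]mulrCA [LHS]mulrC.
    - by rewrite -ih; exact: smooth_sym_sprod.
    - exact: smooth_coord.
  by rewrite sumr_const card_ord !cst_fun_nat factS natrM -mulrA [RHS]mulr_natl.
(* Moving the bound on [a] inside the existential lets choice supply all lower operators at once;
   [id] is a dummy value beyond [r]. *)
have {}ih a : exists D, (a <= r)%N -> [/\ is_diffop D,
  (0 < a)%N -> forall c, D (cst_fun c) = 0 &
  forall k (w : 'I_k -> 'I_n), sym_sprod C _ w a = cst_fun k`!%:R * D (word_fun _ w)].
  have [ar|] := leqP a r; last by move=> _; exists id.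
  by have [D HD] := ih _ ar; exists D.
have /choice[D HD] := ih.
(* These are the terms of positive star order; the index is shifted by one, and [r - a] stands for
   [r.+1 - a.+1]. *)
pose E i f := \sum_(a < r.+1) C a.+1 (D (r - a)%N f) (coord i).
have dE i : is_diffop (E i).
  apply: diffop_sum => a _; apply: bidiffop_diffop => //.
    by have [] := HD _ (leq_subr a r).
  exact: smooth_coord.
have [D' [dD' D'c D'E]] := recurrence_diffop _ dE.
exists D'; split=> //; elim=> [|k ihk] w.
  (* For the empty word the coefficient of positive order is zero, which forces [D'] to vanish on
     constants. *)
  rewrite sym_sprod0 /word_fun big_ord0 (_ : 1 = cst_fun 1)// D'c mulr0.
  exact: erefl.
have -> : cst_fun k.+1`!%:R = cst_fun k`!%:R * cst_fun k.+1%:R :> (V -> R).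
  by rewrite !cst_fun_nat factS natrM mulrC.
rewrite -mulrA D'E sym_sprod_recr// big_distrr/=; apply: eq_bigr => j _.
(* The term of star order 0 keeps the order [r.+1] but shortens the word, so [ihk] applies; the
   others involve only lower orders. *)
rewrite big_ord_recl mulrDr; congr (_ + _).
  rewrite C0 ?subn0 ?ihk.
  - by rewrite [in RHS]mulrCA [LHS]mulrC.
  - by rewrite -ihk; exact: smooth_sym_sprod.
  - exact: smooth_coord.
rewrite /E big_distrr/=; apply: eq_bigr => a _.
have [dDa _ Da] := HD _ (leq_subr a r).
have dC := bidiffop_diffop _ id _ (Cbi a.+1) diffop_id (smooth_coord (w j)).
rewrite subSS Da (diffopZ _ _ _ dC)//.
by apply: diffop_smooth => //; exact: smooth_word_fun.
Qed.

Lemma rho_monoE (l : seq 'I_n) r : rho_mono C l r =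
  cst_fun (size l)`!%:R^-1 * sym_sprod C _ (tnth (in_tuple l)) r.
Proof.
apply/funext => x; rewrite /rho_mono /sym_sprod; congr (_ * _).
rewrite fct_sumE; apply: eq_bigr => s _; congr (sprod C _ r x).
apply: eq_map => j /=.
by rewrite (nth_map (tnth (in_tuple l) j)) ?ltn_ord// -(tnth_nth _ (in_tuple l)).
Qed.

Lemma word_fun_mono_seq m : word_fun _ (tnth (in_tuple (mono_seq m))) =
  fun x : V => \prod_i x 0 i ^+ mpoly.fun_of_multinom m i.
Proof.
rewrite /word_fun -(big_tnth _ _ (mono_seq m) xpredT (@coord R n)).
rewrite /mono_seq big_flatten big_map big_enum/=; apply/funext => x.
rewrite fct_prodE; apply: eq_bigr => i _.
by rewrite big_nseq iter_mulr_1; elim: (mpoly.fun_of_multinom m i) => // k ih;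
  rewrite !exprS -ih.
Qed.

End SunProduct.

Theorem theorem2 (R : realType) (n : nat)
    (P : ('rV[R]_n -> R) -> ('rV[R]_n -> R) -> ('rV[R]_n -> R))
    (C : nat -> ('rV[R]_n -> R) -> ('rV[R]_n -> R) -> ('rV[R]_n -> R)) :
  is_poisson P -> is_star_product P C ->
  forall r : nat, (1 <= r)%N ->
    exists D : ('rV[R]_n -> R) -> ('rV[R]_n -> R),
      [/\ is_diffop D,
          (forall c : R, D (@cst_fun R n c) = @cst_fun R n 0)
        & forall p : mpoly.mpoly n R, rho C r p = D (pol_fun p)].
Proof.
move=> _ [Cbi C0 Cunit _ _] r r0.
have [D [dD Dc DE]] := sym_sprod_diffop C Cbi C0 Cunit r.
exists D; split=> // [|p]; first exact: Dc.
pose X m := word_fun (R := R) _ (tnth (in_tuple (mono_seq (n := n) m))).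
(* By linearity of [D] the claim reduces to monomials, where the $1/k!$ in [rho_mono] cancels the
   factorial in [DE]. *)
have -> : pol_fun p = \sum_(m <- mpoly.msupp p) cst_fun (mpoly.mcoeff m p) * X m.
  apply/funext => x; rewrite fct_sumE /pol_fun mpoly.mevalE.
  by apply: eq_bigr => m _; rewrite /X word_fun_mono_seq.
have sX m : smooth (X m) by exact: smooth_word_fun.
rewrite big_tnth (diffop_lin _ _ _ _ dD) => [|j _]; last first.
  by apply: smoothM; [exact: smooth_cst|exact: sX].
apply/funext => x; rewrite fct_sumE /rho big_tnth; apply: eq_bigr => j _.
rewrite (diffopZ _ _ _ dD (sX _)) rho_monoE DE mulrA.
congr (_ * _); rewrite -[RHS]mul1r; congr (_ * _).
by rewrite /cst_fun /GRing.mul/= mulVf// pnatr_eq0 -lt0n fact_gt0.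
Qed.
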